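(* Let $N$ be an odd squarefree positive integer, let $d$ be a positive divisor of $N$, and let $a\in\mathbb{Z}$ with $\gcd(a,d)=1$. Then $$G_{N-1}(a,d)=\left(\frac ad\right)i^{(N-Nd)/2}d^{N/2}.$$
   Context: $\theta_m(x)=\sum_{i=1}^m x_i^2+\sum_{1\le i<j\le m}x_ix_j$, and for $a\in\mathbb{Z}$, $c\in\mathbb{N}$, $G_m(a,c)=\sum_{x\in(\mathbb{Z}/c\mathbb{Z})^m}e^{2\pi ia\theta_m(x)/c}$ (with $G_0=1$). $\left(\frac ad\right)$ is the Jacobi symbol. *)

(* Defs.v *)
From mathcomp Require Export all_boot all_order all_algebra.
From mathcomp Require Export complex.
From mathcomp Require Export reals exp trigo.

Set Implicit Arguments.
Unset Strict Implicit.
Unset Printing Implicit Defensive.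

Import Order.TTheory GRing.Theory Num.Theory.

Local Open Scope ring_scope.
Local Open Scope complex_scope.

Definition squarefree (n : nat) : Prop :=
  forall k : nat, (k ^ 2 %| n)%N -> k = 1%N.

(* For a prime [p]; the square root is searched among the residues 0..p-1. *)
Definition legendre (a : int) (p : nat) : int :=
  if (p%:Z %| a)%Z then 0
  else if [exists x : 'I_p, ((x : nat)%:Z ^+ 2 == a %[mod p%:Z])%Z] then 1
  else -1.

(* For odd positive [n]. *)
Definition jacobi (a : int) (n : nat) : int :=
  \prod_(p <- primes n) legendre a p ^+ logn p n.

Definition theta (m : nat) (x : 'I_m -> int) : int :=
  \sum_(i < m) x i ^+ 2 + \sum_(i < m) \sum_(j < m | (i < j)%N) x i * x j.

Definition cexpi (R : realType) (t : R) : R[i] := cos t +i* sin t.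

(* For [c > 0].  Elements of Z/cZ are represented by their residues in 'I_c,
   since 'Z_c is not Z/cZ for [c = 1]; the summand only depends on the
   residue classes. *)
Definition gaussG (R : realType) (m : nat) (a : int) (c : nat) : R[i] :=
  \sum_(x : {ffun 'I_m -> 'I_c})
    cexpi (2 * pi * (a * theta (fun i => (x i : nat)%:Z))%:~R / c%:R : R).

(* Main.v *)
(* Write g(psi) for the sum of psi^(x^2) over x in Z/d, psi a primitive d-th root
   of unity.  As 2 theta(x) = sum x_i^2 + (sum x_i)^2, the sum G_{N-1}(a, d) runs
   over the vectors of (Z/d)^N with zero coordinate sum, and since d divides N,
   averaging over diagonal translations identifies it with g(w^(a h))^N, where
   w = exp(2 pi i / d) and h = (d + 1) / 2 is the inverse of 2.

   For squarefree d, the Chinese remainder theorem and a count of square roots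
   modulo primes give g(w^(a h)) = (a/d) g(w^h).

   Finally g(w^h) = i^((1 - d) / 2) sqrt d.  The modulus comes from orthogonality.
   The argument comes from Gauss's identity
     sum_j (-1)^j [2m, j]_q = prod_(k < m) (1 - q^(2k+1))
   for Gaussian binomials: with d = 2m + 1 and q = 1/w its left side is the sum of
   the w^(j (j + 1) / 2), hence g(w^h) up to an explicit root of unity, while the
   right side is an explicit root of unity times a product of positive sines. *)
Require Import Defs.
From mathcomp Require Import zify ring.

Set Implicit Arguments.
Unset Strict Implicit.
Unset Printing Implicit Defensive.

Import Order.TTheory GRing.Theory Num.Theory.

Local Open Scope ring_scope.
Local Open Scope complex_scope.

(** * Additive characters of Z/n and sums of squares *)

(** A character of Z/n as soon as [1 < n] and [w ^+ n = 1]; for [n = 1] the type ['Z_n] has two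
    elements and is not Z/n. *)
Definition zchar (F : fieldType) (n : nat) (w : F) (x : 'Z_n) : F := w ^+ x.

(** Indexed by ['I_n] and not by ['Z_n], so that [n = 1], which arises from an empty product of
    primes, gives a single term. *)
Definition qgauss (F : fieldType) (n : nat) (w : F) : F :=
  \sum_(x < n) w ^+ (x ^ 2).

Section AdditiveCharacter.
Variables (F : fieldType) (n : nat) (w : F).
Hypotheses (n_gt1 : (1 < n)%N) (wn : w ^+ n = 1).
Local Notation e := (@zchar F n w).

Lemma zchar_nat (k : nat) : e k%:R = w ^+ k.
Proof. by rewrite /zchar val_Zp_nat // expr_mod. Qed.

Lemma zcharD (x y : 'Z_n) : e (x + y) = e x * e y.
Proof. by rewrite -[x]natr_Zp -[y]natr_Zp -natrD !zchar_nat exprD. Qed.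

Lemma zchar0 : e 0 = 1.
Proof. by rewrite /zchar expr0. Qed.

Lemma zchar_sum (I : finType) (f : I -> 'Z_n) :
  e (\sum_i f i) = \prod_i e (f i).
Proof. by rewrite (big_morph e zcharD zchar0). Qed.

Lemma zcharMn (x : 'Z_n) (k : nat) : e (x *+ k) = e x ^+ k.
Proof. by elim: k => [|k IH]; rewrite ?zchar0 // mulrS zcharD IH exprS. Qed.

Lemma zcharN (x : 'Z_n) : e (- x) = (e x)^-1.
Proof.
apply/esym/mulr1_eq; rewrite -zcharD subrr; exact: zchar0.
Qed.

Lemma zchar_int (k : int) : e k%:~R = w ^ k.
Proof.
case: k => k; first by rewrite -pmulrn zchar_nat.
by rewrite NegzE mulrNz -pmulrn zcharN zchar_nat -exprnN.
Qed.

Lemma sum_Zp (f : nat -> F) : \sum_(x : 'Z_n) f x = \sum_(x < n) f x.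
Proof. by rewrite -!(big_mkord xpredT f) Zp_cast. Qed.

Lemma qgaussE : qgauss n w = \sum_(x : 'Z_n) e (x ^+ 2).
Proof.
rewrite /qgauss -(sum_Zp (fun x => w ^+ (x ^ 2))); apply: eq_bigr => x _.
by rewrite -{2}[x]natr_Zp -natrX zchar_nat.
Qed.

Hypothesis w_prim : n.-primitive_root w.

Lemma zchar_eq1 (x : 'Z_n) : (e x == 1) = (x == 0).
Proof.
rewrite /zchar -(prim_order_dvd w_prim) -val_eqE /=.
have xn : (x < n)%N by rewrite -[X in (_ < X)%N](Zp_cast n_gt1) ltn_ord.
by rewrite /dvdn modn_small.
Qed.

(** Translating [s] by 1 multiplies the sum by [e t], which differs from 1 unless [t = 0]. *)
Lemma sum_zchar (t : 'Z_n) :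
  \sum_(s : 'Z_n) e (s * t) = if t == 0 then n%:R else 0.
Proof.
case: ifPn => [/eqP ->|t0].
  under eq_bigr do rewrite mulr0 zchar0.
  by rewrite sumr_const card_ord Zp_cast.
have : e t * \sum_(s : 'Z_n) e (s * t) = \sum_(s : 'Z_n) e (s * t).
  rewrite [RHS](reindex_inj (addIr 1)) mulr_sumr; apply: eq_bigr => s _.
  by rewrite mulrDl mul1r zcharD mulrC.
move=> /eqP; rewrite -subr_eq0 -{2}[\sum_(s : 'Z_n) _]mul1r -mulrBl mulf_eq0.
by rewrite subr_eq0 zchar_eq1 (negPf t0) => /eqP.
Qed.

Lemma unit_Zp2 : odd n -> (2%:R : 'Z_n) \is a GRing.unit.
Proof. by move=> nodd; rewrite unitZpE // coprimen2. Qed.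

(** Substituting x = t + y turns the exponent x^2 - y^2 into t^2 + 2ty; by orthogonality the sum
    over y leaves only 2t = 0, that is t = 0. *)
Lemma qgauss_norm : odd n -> qgauss n w * qgauss n w^-1 = n%:R.
Proof.
move=> nodd; have u2 := unit_Zp2 nodd.
have ->: qgauss n w^-1 = \sum_(x : 'Z_n) e (- x ^+ 2).
  rewrite /qgauss -(sum_Zp (fun x => w^-1 ^+ (x ^ 2))); apply: eq_bigr => x _.
  by rewrite zcharN exprVn -[in RHS](natr_Zp x) -natrX zchar_nat.
rewrite qgaussE mulr_sumr.
under eq_bigr => y _.
  rewrite mulr_suml (reindex_inj (addIr y)).
  under eq_bigr => t _.
    rewrite -zcharD (_ : _ - _ = t ^+ 2 + y * (t * 2%:R)); last by ring.
    rewrite zcharD.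
  over.
over.
rewrite exchange_big /=.
under eq_bigr => t _ do rewrite -mulr_sumr sum_zchar.
rewrite (bigD1 (0 : 'Z_n)) // mul0r eqxx expr0n zchar0 mul1r big1 => [|t t0].
  exact: addr0.
by rewrite -(mul0r 2%:R) (inj_eq (mulIr u2)) (negPf t0) mulr0.
Qed.

(* Since [n] divides [m.+1], translating all [m.+1] coordinates by the same [s]
   multiplies the summand of [qgauss n w ^+ m.+1] by [e (2 * s * sum)], and
   averaging over [s] leaves only the vectors with zero coordinate sum. *)
Lemma sum_zchar_rootlattice (m : nat) :
  odd n -> (n %| m.+1)%N -> n%:R != 0 :> F ->
  \sum_(x : {ffun 'I_m -> 'Z_n}) e (\sum_i x i ^+ 2 + (\sum_i x i) ^+ 2) =
  qgauss n w ^+ m.+1.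
Proof.
move=> nodd ndvd nF0; have u2 := unit_Zp2 nodd.
have m0 : (m.+1%:R : 'Z_n) = 0.
  by case/dvdnP: ndvd => k ->; rewrite natrM pchar_Zp // mulr0.
(* One factor of the power is kept apart: [z] is the last of the [m.+1] coordinates. *)
have powE : qgauss n w ^+ m.+1 = \sum_(x : {ffun 'I_m -> 'Z_n})
    \sum_(z : 'Z_n) e (\sum_i x i ^+ 2 + z ^+ 2).
  rewrite exprSr qgaussE -[X in _ ^+ X](card_ord m) -prodr_const.
  rewrite bigA_distr_bigA mulr_suml; apply: eq_bigr => x _.
  by rewrite mulr_sumr; apply: eq_bigr => z _; rewrite zcharD zchar_sum.
have shift (s : 'Z_n) : qgauss n w ^+ m.+1 = \sum_(x : {ffun 'I_m -> 'Z_n})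
    \sum_(z : 'Z_n) e (\sum_i x i ^+ 2 + z ^+ 2) *
      e (s * ((\sum_i x i + z) * 2%:R)).
  rewrite powE.
  pose h (x : {ffun 'I_m -> 'Z_n}) := [ffun i => x i + s].
  have h_inj : injective h.
    move=> x y /ffunP xy; apply/ffunP => i; have := xy i; rewrite !ffunE.
    exact: addIr.
  rewrite (reindex_inj h_inj); apply: eq_bigr => x _.
  rewrite (reindex_inj (addIr s)); apply: eq_bigr => z _.
  rewrite -zcharD; congr (e _).
  under eq_bigr => i _ do rewrite ffunE sqrrD.
  rewrite !big_split /= sumr_const card_ord -mulr_suml -[s ^+ 2 *+ m]mulr_natr.
  (* The two arguments differ by [s ^+ 2 * m.+1%:R], which is zero in Z/n. *)
  have := congr1 (fun t => s ^+ 2 * t) m0; rewrite mulr0 -natr1 => E0.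
  by apply/eqP; rewrite -subr_eq0 -[X in _ == X]E0; apply/eqP; ring.
(* Both sides are multiplied by [n] in order to sum over all shifts [s]; orthogonality then forces
   [z = - \sum_i x i]. *)
apply: (mulfI nF0).
rewrite [RHS]mulr_natl -[X in _ = _ *+ X](Zp_cast n_gt1).
rewrite -[X in _ = _ *+ X](card_ord (Zp_trunc n).+2).
rewrite -sumr_const (eq_bigr _ (fun s _ => shift s)) exchange_big mulr_sumr /=.
apply: eq_bigr => x _; rewrite exchange_big /= (bigD1 (- \sum_i x i)) //=.
rewrite -mulr_sumr sum_zchar subrr mul0r eqxx sqrrN mulrC.
rewrite [X in _ = _ + X]big1 ?addr0 // => z zx.
have xz0 : \sum_i x i + z != 0 by rewrite addrC addr_eq0.
rewrite -mulr_sumr sum_zchar; case: eqP => [/eqP|_]; last exact: mulr0.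
by rewrite -[X in _ == X](mul0r 2%:R) (inj_eq (mulIr u2)) (negPf xz0).
Qed.

End AdditiveCharacter.

Lemma zchar_exprz (F : fieldType) (n : nat) (w : F) (a : int) (x : 'Z_n) :
  (1 < n)%N -> w ^+ n = 1 -> zchar (w ^ a) x = zchar w (a%:~R * x).
Proof.
move=> n_gt1 wn; rewrite -[in RHS](natr_Zp x) mulr_natr zcharMn // zchar_int //.
Qed.

(** * Dependence of the Gauss sum on the root of unity *)

Lemma card_sqrt_le1 (K : finFieldType) (c : K) :
  c != 0 -> (#|[set x | (c * x ^+ 2 == 0)%R]| <= 1)%N.
Proof.
move=> c0; rewrite -(cards1 (0 : K)) subset_leq_card //; apply/subsetP => x.
by rewrite !inE mulf_eq0 (negPf c0) expf_eq0.
Qed.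

Lemma card_sqrt_le2 (K : finFieldType) (c y : K) :
  c != 0 -> (#|[set x | (c * x ^+ 2 == y)%R]| <= 2)%N.
Proof.
move=> c0; have [->|[z]] := set_0Vmem [set x | c * x ^+ 2 == y].
  by rewrite cards0.
rewrite inE => /eqP <-; apply: (@leq_trans #|[set z; - z]|); last first.
  by rewrite cards2; case: eqP.
apply: subset_leq_card; apply/subsetP => x; rewrite !inE.
by rewrite (inj_eq (mulfI c0)) eqf_sqr.
Qed.

Lemma sum_card_sqrt (K : finFieldType) (c : K) :
  (\sum_y #|[set x | (c * x ^+ 2 == y)%R]| = #|K|)%N.
Proof.
rewrite -[RHS]sum1_card [RHS](partition_big (fun x => c * x ^+ 2) xpredT) //=.
apply: eq_bigr => y _; rewrite -[LHS]sum1_card; apply: eq_bigl => x.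
by rewrite inE.
Qed.

(** The two counts add up to at most 2: for [y != 0] they cannot both be positive, as [c] would be a
    square. Summed over all y they give 2|K|, so equality holds for each y. *)
Lemma card_sqrt_nonsquare (K : finFieldType) (c y : K) :
  c != 0 -> (forall z, z ^+ 2 != c) ->
  (#|[set x | (1 * x ^+ 2 == y)%R]| + #|[set x | (c * x ^+ 2 == y)%R]| = 2)%N.
Proof.
move=> c0 nsq.
pose r z := (#|[set x | (1 * x ^+ 2 == z)%R]| +
             #|[set x | (c * x ^+ 2 == z)%R]|)%N.
have r_le2 z : (r z <= 2)%N.
  rewrite /r; have [->|z0] := eqVneq z 0.
    by rewrite -[2%N]/(1 + 1)%N leq_add ?card_sqrt_le1 ?oner_neq0.
  have [->|[x1]] := set_0Vmem [set x | c * x ^+ 2 == z].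
    by rewrite cards0 addn0 card_sqrt_le2 ?oner_neq0.
  rewrite inE => /eqP Ez.
  have [->|[x0]] := set_0Vmem [set x | 1 * x ^+ 2 == z].
    by rewrite cards0 card_sqrt_le2.
  rewrite inE mul1r -Ez => /eqP E0; have x10 : x1 != 0.
    by apply: contraNneq z0 => x10; rewrite -Ez x10 expr0n mulr0.
  by case/negP: (nsq (x0 / x1)); rewrite expr_div_n E0 mulfK ?expf_neq0.
have := leqif_sum (fun z (_ : xpredT z) => leqif_eq (r_le2 z)).
rewrite /r big_split /= !sum_card_sqrt sum_nat_const muln2 addnn => -[_].
by rewrite eqxx => /esym/forallP/(_ y)/eqP.
Qed.

Lemma sum_sqr_nonsquare (K : finFieldType) (V : zmodType) (c : K) (f : K -> V) :
  c != 0 -> (forall z, z ^+ 2 != c) ->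
  \sum_x f (x ^+ 2) + \sum_x f (c * x ^+ 2) = (\sum_y f y) *+ 2.
Proof.
move=> c0 nsq.
have sumE (b : K) : \sum_x f (b * x ^+ 2) =
    \sum_y f y *+ #|[set x | (b * x ^+ 2 == y)%R]|.
  rewrite [LHS](partition_big (fun x => b * x ^+ 2) xpredT) //=.
  apply: eq_bigr => y _; rewrite -sumr_const.
  by apply: eq_big => [x|x /eqP -> //]; rewrite inE.
rewrite (eq_bigr (fun x => f (1 * x ^+ 2))) => [|x _]; last by rewrite mul1r.
rewrite !sumE -big_split -sumrMnl; apply: eq_bigr => y _ /=.
by rewrite -mulrnDr card_sqrt_nonsquare.
Qed.

Lemma legendreE (a : int) (p : nat) : prime p -> ~~ (p%:Z %| a)%Z ->
  legendre a p = if [exists z : 'F_p, z ^+ 2 == a%:~R] then 1 else -1.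
Proof.
move=> pr pa; rewrite /legendre (negPf pa).
have mod_Fp (k : nat) :
    (k%:Z ^+ 2 == a %[mod p%:Z])%Z = (k%:R ^+ 2 == a%:~R :> 'F_p).
  rewrite eqz_mod_dvd (dvdz_pcharf (pchar_Fp pr)) intrB subr_eq0.
  by rewrite rmorphXn /= -pmulrn.
congr (if _ then _ else _); apply/existsP/existsP => -[z]; first last.
  rewrite -[z]natr_Zp -mod_Fp.
  have zp : (z < p)%N by rewrite -[X in (_ < X)%N](Fp_cast pr) ltn_ord.
  by exists (Ordinal zp).
by rewrite mod_Fp; exists z%:R.
Qed.

(** If a = z^2 modulo p, substitute zx for x. If a is not a square, the two Gauss sums add up to
    twice the full sum of a nontrivial character, which is 0. *)
Lemma qgauss_legendre (F : fieldType) (p : nat) (w : F) (a : int) :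
  prime p -> p.-primitive_root w -> ~~ (p%:Z %| a)%Z ->
  qgauss p (w ^ a) = (legendre a p)%:~R * qgauss p w.
Proof.
move=> pr w_prim pa; rewrite legendreE //.
have a0 : a%:~R != 0 :> 'F_p by rewrite -(dvdz_pcharf (pchar_Fp pr)).
(* ['F_p] unfolds to ['Z_(pdiv p)], so the facts on characters are applied at [pdiv p]. *)
have P_gt1 : (1 < pdiv p)%N by rewrite pdiv_id // prime_gt1.
have W_prim : (pdiv p).-primitive_root w by rewrite pdiv_id.
have wP := prim_expr_order W_prim.
have waP : (w ^ a) ^+ pdiv p = 1.
  by rewrite -[_ ^+ _]/((w ^ a) ^ (pdiv p)%:Z) exprzAC -exprnP wP exp1rz.
have gE u : u ^+ pdiv p = 1 -> qgauss p u = \sum_(x : 'F_p) zchar u (x ^+ 2).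
  by move=> uP; rewrite -qgaussE // pdiv_id.
rewrite !gE //; under eq_bigr => x _ do rewrite zchar_exprz //.
case: existsP => [[z /eqP za]|nsq].
  rewrite mul1r; have z0 : z != 0 by rewrite -sqrf_eq0 za.
  rewrite [RHS](reindex_inj (mulfI z0)); apply: eq_bigr => x _.
  by rewrite exprMn za.
have := @sum_sqr_nonsquare 'F_p F a%:~R (zchar w) a0 _.
rewrite mulN1r => E; apply/eqP; rewrite -addr_eq0 addrC E.
  have := sum_zchar P_gt1 wP W_prim 1; rewrite oner_eq0.
  by under eq_bigr do rewrite mulr1; move=> ->; rewrite mul0rn.
by move=> z; apply/negP => zE; apply: nsq; exists z.
Qed.

Lemma modn_mul_inj (p m u v : nat) : coprime p m ->
  (m * u = m * v %[mod p])%N -> (u = v %[mod p])%N.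
Proof.
move=> cpm; wlog uv : u v / (v <= u)%N => [H E|].
  by have [/H|/ltnW/H] := leqP v u; [exact|move=> H'; apply/esym/H'].
move=> /eqP; rewrite eqn_mod_dvd ?leq_mul2l ?uv ?orbT // -mulnBr Gauss_dvdr //.
by rewrite -eqn_mod_dvd // => /eqP.
Qed.

(** By the Chinese remainder theorem mu + pv runs over the residues modulo pm; the cross term 2pmuv
    of its square disappears from the exponent. *)
Lemma qgaussM (F : fieldType) (p m : nat) (w : F) :
  coprime p m -> (0 < p)%N -> (0 < m)%N -> w ^+ (p * m) = 1 ->
  qgauss (p * m) w = qgauss p (w ^+ (m ^ 2)) * qgauss m (w ^+ (p ^ 2)).
Proof.
move=> cpm p0 m0 wpm.
have pm0 : (0 < p * m)%N by rewrite muln_gt0 p0.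
pose h (u : 'I_p * 'I_m) : 'I_(p * m) :=
  Ordinal (ltn_pmod (m * u.1 + p * u.2) pm0).
have h_inj : injective h.
  move=> [u v] [u' v'] [] /= E.
  have Ep : (m * u = m * u' %[mod p])%N.
    have := congr1 (modn^~ p) E; rewrite !modn_dvdm ?dvdn_mulr //.
    by rewrite ![(m * _ + _)%N]addnC !(mulnC p) !modnMDl.
  have Em : (p * v = p * v' %[mod m])%N.
    have := congr1 (modn^~ m) E; rewrite !modn_dvdm ?dvdn_mull //.
    by rewrite !(mulnC m) !modnMDl.
  have := modn_mul_inj cpm Ep; rewrite !modn_small // => /val_inj ->.
  have := modn_mul_inj _ Em; rewrite coprime_sym !modn_small // => /(_ cpm).
  by move=> /val_inj ->.
have h_bij : bijective h.
  by apply: inj_card_bij h_inj _; rewrite card_prod !card_ord.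
rewrite /qgauss (reindex h) /=; last exact: onW_bij.
rewrite -(pair_bigA _ (fun (u : 'I_p) (v : 'I_m) =>
  w ^+ (((m * u + p * v) %% (p * m)) ^ 2))) /=.
rewrite mulr_suml; apply: eq_bigr => u _; rewrite mulr_sumr.
apply: eq_bigr => v _; rewrite -(expr_mod (_ ^ 2)%N wpm) modnXm expr_mod //.
rewrite -!exprM -exprD.
have ->: ((m * u + p * v) ^ 2 =
  m ^ 2 * u ^ 2 + p ^ 2 * v ^ 2 + p * m * (2 * u * v))%N by ring.
by rewrite exprD (exprM _ (p * m)) wpm expr1n mulr1.
Qed.

(** Induction with [w] varying: splitting off p replaces [w] by its powers of exponents m^2 and p^2,
    which are primitive of orders p and m, and these powers commute with raising to the power
    [a]. *)
Lemma qgauss_prod_legendre (F : fieldType) (s : seq nat) (w : F) (a : int) :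
  all prime s -> uniq s -> (forall p, p \in s -> ~~ (p%:Z %| a)%Z) ->
  (\prod_(p <- s) p)%N.-primitive_root w ->
  qgauss (\prod_(p <- s) p) (w ^ a) =
    (\prod_(p <- s) legendre a p)%:~R * qgauss (\prod_(p <- s) p) w.
Proof.
elim: s w => [|p s IH] w /=.
  by rewrite !big_nil mul1r /qgauss !big_ord1 !expr0.
move=> /andP[pr sprime] /andP[ps us] sa; rewrite !big_cons.
set m := (\prod_(q <- s) q)%N => w_prim.
have p0 := prime_gt0 pr.
have m0 : (0 < m)%N.
  by rewrite /m big_seq prodn_cond_gt0 // => q /(allP sprime)/prime_gt0.
have cpm : coprime p m.
  rewrite /m big_seq; elim/big_ind: _ => [|x y|q qs]; first exact: coprimen1.
    by rewrite coprimeMr => -> ->.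
  rewrite prime_coprime // dvdn_prime2 ?(allP sprime q qs) //.
  by apply: contraNneq ps => ->.
have wpm := prim_expr_order w_prim.
have wa : (w ^ a) ^+ (p * m) = 1.
  by rewrite -[_ ^+ _]/((w ^ a) ^ (p * m)%:Z) exprzAC -exprnP wpm exp1rz.
have powC k : (w ^ a) ^+ k = (w ^+ k) ^ a.
  by rewrite -[LHS]/((w ^ a) ^ k%:Z) exprzAC.
have primP : p.-primitive_root (w ^+ (m ^ 2)).
  have wm : p.-primitive_root (w ^+ m).
    by have := dvdn_prim_root w_prim (dvdn_mulr m (dvdnn p)); rewrite mulKn.
  by rewrite -mulnn exprM (prim_root_exp_coprime m wm) coprime_sym.
have primM : m.-primitive_root (w ^+ (p ^ 2)).
  have wp : m.-primitive_root (w ^+ p).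
    by have := dvdn_prim_root w_prim (dvdn_mull p (dvdnn m)); rewrite mulnK.
  by rewrite -mulnn exprM (prim_root_exp_coprime p wp).
rewrite !qgaussM // !powC qgauss_legendre // ?sa ?mem_head // IH //; last first.
  by move=> q qs; rewrite sa // inE qs orbT.
by rewrite rmorphM /= mulrACA.
Qed.

(** * Squarefree moduli and the Jacobi symbol *)

Lemma logn_squarefree (n p : nat) :
  squarefree n -> p \in primes n -> logn p n = 1%N.
Proof.
move=> sf; rewrite mem_primes => /and3P[pr n0 pn]; apply/eqP.
rewrite eqn_leq logn_gt0 mem_primes pr n0 pn !andbT leqNgt; apply/negP => lt1.
have := sf p; rewrite pfactor_dvdn // => /(_ lt1) p1.
by rewrite p1 in pr.
Qed.

Lemma prod_primes_squarefree (n : nat) : (0 < n)%N -> squarefree n ->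
  (\prod_(p <- primes n) p)%N = n.
Proof.
move=> n0 sf; rewrite [RHS](prod_prime_decomp n0) prime_decompE big_map.
rewrite !big_seq; apply: eq_bigr => p pn /=.
by rewrite logn_squarefree // expn1.
Qed.

Lemma jacobi_squarefree (n : nat) (a : int) : squarefree n ->
  jacobi a n = \prod_(p <- primes n) legendre a p.
Proof.
move=> sf; rewrite /jacobi !big_seq; apply: eq_bigr => p pn.
by rewrite logn_squarefree // expr1.
Qed.

Lemma coprimez_ndvd (n p : nat) (a : int) :
  gcdz a n%:Z = 1 -> p \in primes n -> ~~ (p%:Z %| a)%Z.
Proof.
move=> ga; rewrite mem_primes => /and3P[pr _ pn]; apply/negP => pa.
have : (p%:Z %| gcdz a n%:Z)%Z by rewrite dvdz_gcd pa.
by rewrite ga dvdz1 /= => /eqP p1; rewrite p1 in pr.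
Qed.

Lemma qgauss_jacobi (F : fieldType) (n : nat) (w : F) (a : int) :
  squarefree n -> gcdz a n%:Z = 1 -> n.-primitive_root w ->
  qgauss n (w ^ a) = (jacobi a n)%:~R * qgauss n w.
Proof.
move=> sf ga w_prim; have n0 := prim_order_gt0 w_prim.
have := @qgauss_prod_legendre F (primes n) w a.
rewrite prod_primes_squarefree // jacobi_squarefree //; apply => //.
- exact: all_prime_primes.
- exact: primes_uniq.
- by move=> p; apply: coprimez_ndvd.
Qed.

(** Every factor is 1 or -1; this reduces an odd power of the symbol to the symbol itself. *)
Lemma jacobi_sqr (n : nat) (a : int) :
  gcdz a n%:Z = 1 -> jacobi a n ^+ 2 = 1.
Proof.
move=> ga; rewrite /jacobi -prodrXl big_seq big1 // => p pn.
rewrite exprAC /legendre (negPf (coprimez_ndvd ga pn)).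
by case: ifP => _; rewrite ?sqrrN !expr1n.
Qed.

(** * Gauss's product formula *)

Section GaussianBinomial.
Variables (F : fieldType) (n : nat) (q : F).
Hypothesis q_neq1 : forall k, (0 < k < n)%N -> 1 - q ^+ k != 0.

(** The q-Pochhammer symbol (q; q)_m. *)
Definition qfact (m : nat) : F := \prod_(i < m) (1 - q ^+ i.+1).

(** The Gaussian binomial for j <= m < n, where the denominator is nonzero; it need not vanish for j
    > m. *)
Definition qbin (m j : nat) : F := qfact m / (qfact j * qfact (m - j)).

Lemma qfactS (m : nat) : qfact m.+1 = qfact m * (1 - q ^+ m.+1).
Proof. by rewrite /qfact big_ord_recr. Qed.

Lemma qfact_neq0 (m : nat) : (m < n)%N -> qfact m != 0.
Proof.
move=> mn; apply/prodf_neq0 => i _; apply: q_neq1.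
exact: leq_ltn_trans (ltn_ord i) mn.
Qed.

Lemma qbin0 (m : nat) : (m < n)%N -> qbin m 0 = 1.
Proof.
by move=> mn; rewrite /qbin subn0 /qfact big_ord0 mul1r divff // qfact_neq0.
Qed.

Lemma qbinn (m : nat) : (m < n)%N -> qbin m m = 1.
Proof.
by move=> mn; rewrite /qbin subnn {3}/qfact big_ord0 mulr1 divff // qfact_neq0.
Qed.

(** The q-Pascal rule, with j < m because [qbin m m.+1] is not the usual zero. *)
Lemma qbinS (m j : nat) : (m.+1 < n)%N -> (j < m)%N ->
  qbin m.+1 j.+1 = qbin m j.+1 + q ^+ (m - j) * qbin m j.
Proof.
move=> mn jm; have [k Em] : exists k, m = (j + k.+1)%N.
  by exists (m - j.+1)%N; lia.
have -> : (m - j)%N = k.+1 by lia.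
rewrite /qbin subSS (_ : (m - j = k.+1)%N) 1?(_ : (m - j.+1 = k)%N); try lia.
have jn : qfact j != 0 by apply: qfact_neq0; lia.
have kn : qfact k != 0 by apply: qfact_neq0; lia.
have j1 : 1 - q ^+ j.+1 != 0 by apply: q_neq1; lia.
have k1 : 1 - q ^+ k.+1 != 0 by apply: q_neq1; lia.
rewrite !qfactS (_ : q ^+ m.+1 = q ^+ j.+1 * q ^+ k.+1); last first.
  by rewrite -exprD; congr (_ ^+ _); lia.
by field; rewrite jn kn j1 k1.
Qed.

Lemma qbin_absorb (m j : nat) : (m.+1 < n)%N -> (j <= m)%N ->
  (1 - q ^+ (m.+1 - j)) * qbin m.+1 j = (1 - q ^+ m.+1) * qbin m j.
Proof.
move=> mn jm; rewrite /qbin subSn // !qfactS.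
have jn : qfact j != 0 by apply: qfact_neq0; lia.
have kn : qfact (m - j) != 0 by apply: qfact_neq0; lia.
have k1 : 1 - q ^+ (m - j).+1 != 0 by apply: q_neq1; lia.
by field; rewrite jn kn k1.
Qed.

Lemma qbin_step (m j : nat) : (m < n)%N -> (j < m)%N ->
  (1 - q ^+ j.+1) * qbin m j.+1 = (1 - q ^+ (m - j)) * qbin m j.
Proof.
move=> mn jm; have Ek : (m - j)%N = (m - j.+1).+1 by lia.
rewrite /qbin Ek !qfactS.
have jn : qfact j != 0 by apply: qfact_neq0; lia.
have kn : qfact (m - j.+1) != 0 by apply: qfact_neq0; lia.
have j1 : 1 - q ^+ j.+1 != 0 by apply: q_neq1; lia.
have k1 : 1 - q ^+ (m - j.+1).+1 != 0 by apply: q_neq1; lia.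
by field; rewrite jn kn j1 k1.
Qed.

(** Apply the q-Pascal rule to the inner terms. The shifted sum of [f] cancels the two end terms,
    leaving the terms (1 - q^(m+1-i)) f(i), from which absorption extracts the factor 1 -
    q^(m+1). *)
Lemma altsum_qbinSS (m : nat) : (m.+2 < n)%N ->
  \sum_(j < m.+3) (-1) ^+ j * qbin m.+2 j =
  (1 - q ^+ m.+1) * \sum_(j < m.+1) (-1) ^+ j * qbin m j.
Proof.
move=> mn; have mn1 := ltnW mn; have mn0 := ltnW mn1.
pose f j := (-1) ^+ j * qbin m.+1 j.
rewrite big_ord_recl big_ord_recr /= qbin0 // qbinn // mulr1 expr0.
have -> : \sum_(i < m.+1) (-1) ^+ bump 0 i * qbin m.+2 (bump 0 i) =
    \sum_(i < m.+1) f i.+1 - \sum_(i < m.+1) q ^+ (m.+1 - i) * f i.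
  rewrite -sumrB; apply: eq_bigr => i _.
  rewrite /bump leq0n add1n qbinS // /f exprS; ring.
have -> : \sum_(i < m.+1) f i.+1 = \sum_(i < m.+1) f i - 1 + (-1) ^+ m.+1.
  have f0 : f 0%N = 1 by rewrite /f qbin0 // mul1r.
  have fm : f m.+1 = (-1) ^+ m.+1 by rewrite /f qbinn // mulr1.
  have E : \sum_(i < m.+2) f i = 1 + \sum_(i < m.+1) f i.+1.
    by rewrite big_ord_recl f0.
  by rewrite big_ord_recr /= fm in E; apply: (addrI 1); rewrite -E; ring.
rewrite mulr_sumr.
rewrite [RHS](eq_bigr (fun i : 'I_m.+1 => f i - q ^+ (m.+1 - i) * f i)).
  by rewrite sumrB /bump /= add1n !exprS; ring.
move=> i _; rewrite mulrCA -qbin_absorb ?leq_ord // /f; ring.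
Qed.

(** Gauss's identity: each increase of the upper index by 2 contributes the next odd exponent. *)
Lemma altsum_qbin (m : nat) : (m.*2 < n)%N ->
  \sum_(j < m.*2.+1) (-1) ^+ j * qbin m.*2 j = \prod_(k < m) (1 - q ^+ k.*2.+1).
Proof.
elim: m => [|m IH] mn.
  by rewrite big_ord1 big_ord0 expr0 mul1r qbin0.
by rewrite doubleS altsum_qbinSS // [RHS]big_ord_recr /= IH 1?mulrC //; lia.
Qed.

End GaussianBinomial.

(** * Gauss's identity at a primitive root of unity of odd order *)

Lemma prim_root_neq0 (F : fieldType) (n : nat) (w : F) :
  n.-primitive_root w -> w != 0.
Proof.
move=> w_prim; apply/eqP => w0; have := prim_expr_order w_prim.
move/eqP; rewrite w0 expr0n gtn_eqF ?(prim_order_gt0 w_prim) //.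
by rewrite eq_sym oner_eq0.
Qed.

Section GaussProduct.
Variables (F : fieldType) (m : nat) (w : F).
Let n := m.*2.+1.
Hypothesis w_prim : n.-primitive_root w.

Lemma prim_root_inv_neq1 (k : nat) : (0 < k < n)%N -> 1 - w^-1 ^+ k != 0.
Proof.
move=> /andP[k0 kn]; rewrite subr_eq0 eq_sym exprVn invr_eq1.
by rewrite -(prim_order_dvd w_prim) gtnNdvd.
Qed.

(** For q = 1/w one has q^(2m-j) = w^(j+1), so consecutive binomials have ratio (1 - w^(j+1)) / (1 -
    w^(-j-1)) = -w^(j+1). *)
Lemma qbin_prim_root (j : nat) : (j <= m.*2)%N ->
  qbin w^-1 m.*2 j = (-1) ^+ j * w ^+ 'C(j.+1, 2).
Proof.
have w0 : w != 0 := prim_root_neq0 w_prim.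
elim: j => [|j IH] jn.
  by rewrite (qbin0 prim_root_inv_neq1) // mul1r.
have j1 : 1 - w^-1 ^+ j.+1 != 0 by apply: prim_root_inv_neq1; lia.
apply: (mulfI j1); rewrite (qbin_step prim_root_inv_neq1) // IH 1?ltnW //.
have -> : w^-1 ^+ (m.*2 - j) = w ^+ j.+1.
  rewrite exprVn -[LHS]mulr1 -(prim_expr_order w_prim).
  have -> : n = (m.*2 - j + j.+1)%N by rewrite /n; lia.
  by rewrite exprD mulKf // expf_neq0.
rewrite (binS j.+1) bin1 exprD exprVn (exprS (-1)); field.
by rewrite expf_neq0.
Qed.

Lemma sum_triangular_prim_root :
  \sum_(j < n) w ^+ 'C(j.+1, 2) = \prod_(k < m) (1 - w^-1 ^+ k.*2.+1).
Proof.
rewrite -(altsum_qbin prim_root_inv_neq1) //; apply: eq_bigr => j _.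
rewrite qbin_prim_root ?leq_ord // mulrA -expr2 -exprM mulnC exprM sqrrN.
by rewrite !expr1n mul1r.
Qed.

(* [h = m.+1] is the inverse of 2 modulo [n], so completing the square gives
   [j (j + 1) / 2 = h (j + h)^2 - h^3] modulo [n]. *)
Lemma half_square_mod (j : nat) : (m.+1 * (j + m.+1) ^ 2 =
  m.+1 ^ 3 + 'C(j.+1, 2) + n * ('C(j.+1, 2) + m.+1 * j))%N.
Proof.
have triE : ('C(j.+1, 2) * 2 = j * j.+1)%N.
  by elim: j => [|k IH]; rewrite // binS bin1 mulnDl IH; ring.
transitivity (m.+1 ^ 3 + ('C(j.+1, 2) * 2) * m.+1 + n * (m.+1 * j))%N.
  by rewrite triE /n -addnn; ring.
by rewrite /n -addnn; ring.
Qed.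

Lemma qgauss_half_prod :
  qgauss n (w ^+ m.+1) =
  w ^+ (m.+1 ^ 3) * \prod_(k < m) (1 - w^-1 ^+ k.*2.+1).
Proof.
have wn := prim_expr_order w_prim.
(* For m = 0 the modulus is 1 and ['Z_n] cannot serve as index set. *)
have [m0|m0] := posnP m.
  have w1 : w = 1 by rewrite /n m0 in wn.
  by rewrite /n w1 !expr1n /qgauss m0 big_ord1 big_ord0 !mul1r.
have n1 : (1 < n)%N by rewrite /n; lia.
have wh : (w ^+ m.+1) ^+ n = 1 by rewrite exprAC wn expr1n.
rewrite -sum_triangular_prim_root mulr_sumr qgaussE //.
rewrite (reindex_inj (addIr (m.+1%:R : 'Z_n))).
rewrite -(sum_Zp n1 (fun j => w ^+ (m.+1 ^ 3) * w ^+ 'C(j.+1, 2))).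
apply: eq_bigr => x _.
rewrite -{1}[x]natr_Zp -natrD -natrX zchar_nat // -exprM -exprD.
by rewrite half_square_mod exprD (exprM w n) wn expr1n mulr1.
Qed.

End GaussProduct.

Lemma coprime_half_succ (n : nat) : odd n -> coprime n./2.+1 n.
Proof.
move=> nodd; have : coprime (2 * n./2.+1) n.
  by rewrite (_ : (2 * n./2.+1 = n.+1)%N) ?coprimeSn //; lia.
by rewrite coprimeMl => /andP[].
Qed.

Lemma prim_root_exprz (F : fieldType) (n : nat) (w : F) (a : int) :
  n.-primitive_root w -> gcdz a n%:Z = 1 -> n.-primitive_root (w ^ a).
Proof.
move=> w_prim ga; have n0 := prim_order_gt0 w_prim.
have w0 : w != 0 := prim_root_neq0 w_prim.
have nZ0 : n%:Z != 0 by rewrite -lt0n.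
(* Reduce [a] modulo [n] to get a natural exponent coprime to [n]. *)
rewrite (divz_eq a n%:Z) expfzDr // mulrC (mulrC (a %/ n)%Z) -exprz_exp.
rewrite -exprnP (prim_expr_order w_prim) exp1rz mulr1.
have -> : (a %% n)%Z = `|(a %% n)%Z|%N :> int by rewrite gez0_abs // modz_ge0.
rewrite -exprnP prim_root_exp_coprime //.
have := gcdz_modl a n%:Z; rewrite ga /gcdz /coprime => /eqP.
by rewrite absz_nat.
Qed.

(** * The sign of the Gauss sum *)

Section ComplexExponential.
Variable R : realType.
Implicit Types t : R.

Lemma cexpiD t u : cexpi (t + u) = cexpi t * cexpi u.
Proof.
rewrite /cexpi cosD sinD; apply/eqP; rewrite eq_complex /= eqxx /=.
by rewrite addrC.
Qed.

Lemma cexpi0 : cexpi (0 : R) = 1.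
Proof. by rewrite /cexpi cos0 sin0. Qed.

Lemma cexpiN t : cexpi (- t) = (cexpi t)^-1.
Proof. by apply/esym/mulr1_eq; rewrite -cexpiD subrr cexpi0. Qed.

Lemma cexpi_neq0 t : cexpi t != 0.
Proof.
by apply/negP => /eqP t0; have := cexpiD t (- t);
   rewrite subrr cexpi0 t0 mul0r => /eqP; rewrite oner_eq0.
Qed.

Lemma cexpiMn t (k : nat) : cexpi (t * k%:R) = cexpi t ^+ k.
Proof.
elim: k => [|k IH]; first by rewrite mulr0 cexpi0.
by rewrite -natr1 mulrDr mulr1 cexpiD IH exprSr.
Qed.

Lemma cexpi_int t (k : int) : cexpi (t * k%:~R) = cexpi t ^ k.
Proof.
case: k => k; first by rewrite -pmulrn cexpiMn.
by rewrite NegzE mulrNz mulrN cexpiN -pmulrn cexpiMn -exprnN.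
Qed.

Lemma conjc_cexpi t : conjc (cexpi t) = (cexpi t)^-1.
Proof. by rewrite -cexpiN /cexpi cosN sinN. Qed.

Lemma cexpi_pi : cexpi (pi : R) = -1.
Proof.
by apply/eqP; rewrite /cexpi cospi sinpi eq_complex /= oppr0 !eqxx.
Qed.

Lemma cexpiB t : cexpi t - (cexpi t)^-1 = 'i%C * (2 * sin t)%:C.
Proof.
rewrite -cexpiN /cexpi cosN sinN; apply/eqP; rewrite eq_complex /=.
by apply/andP; split; apply/eqP; ring.
Qed.

Lemma cexpi_prim_root (n : nat) : (0 < n)%N ->
  n.-primitive_root (cexpi (2 * pi / n%:R : R)).
Proof.
move=> n0; have nR0 : (n%:R : R) != 0 by rewrite pnatr_eq0 -lt0n.
have wn : cexpi (2 * pi / n%:R : R) ^+ n = 1.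
  rewrite -cexpiMn divfK // mulrC mulr_natr mulr2n cexpiD cexpi_pi.
  by rewrite mulrNN mulr1.
apply/andP; split => //; apply/forallP => i; rewrite unity_rootE.
have := ltn_ord i; rewrite leq_eqVlt => /orP[/eqP ->|lt_in].
  by rewrite wn !eqxx.
rewrite (ltn_eqF lt_in) eqbF_neg; apply/negP.
(* At the half angle [t], a trivial power would make [cexpi t] its own inverse, hence sin t = 0,
   although 0 < t < pi. *)
set t : R := pi * i.+1%:R / n%:R.
have t_bnd : 0 < t < pi.
  rewrite /t divr_gt0 ?mulr_gt0 ?pi_gt0 ?ltr0n //=.
  by rewrite ltr_pdivrMr ?ltr0n // ltr_pM2l ?pi_gt0 // ltr_nat.
rewrite -cexpiMn (_ : _ * _ = t + t); last by rewrite /t; field.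
rewrite cexpiD => /eqP tt; have := cexpiB t.
have -> : (cexpi t)^-1 = cexpi t by apply: mulr1_eq.
rewrite subrr => /esym/eqP; rewrite mulf_eq0 complexiE (negPf (neq0Ci _)) /=.
by rewrite fmorph_eq0 mulf_eq0 pnatr_eq0 /= gt_eqF // sin_gt0_pi.
Qed.

Lemma sum_odd (m : nat) : (\sum_(k < m) k.*2.+1 = m ^ 2)%N.
Proof.
by elim: m => [|m IH]; rewrite ?big_ord0 // big_ord_recr /= IH -addnn; ring.
Qed.

(** With v = exp(pi i / n) and w = v^2, each factor 1 - w^(-(2k+1)) is v^(-(2k+1)) times 2i sin(pi
    (2k+1) / n), and the sine is positive since 2k + 1 < n. *)
Lemma qgauss_half_pos (m : nat) : exists2 P : R, 0 < P &
  qgauss m.*2.+1 (cexpi (2 * pi / m.*2.+1%:R : R) ^+ m.+1) =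
  (- 'i%C) ^+ m * P%:C.
Proof.
set n := m.*2.+1; set w := cexpi _.
have nR0 : (n%:R : R) != 0 by rewrite pnatr_eq0.
pose t : R := pi / n%:R; pose v := cexpi t.
have v0 : v != 0 := cexpi_neq0 t.
have wE : w = v ^+ 2 by rewrite /w /v -cexpiMn /t; congr cexpi; ring.
have vn : v ^+ n = -1 by rewrite /v -cexpiMn /t divfK // cexpi_pi.
exists (\prod_(k < m) (2 * sin (t * k.*2.+1%:R))).
  apply: prodr_gt0 => k _; rewrite mulr_gt0 // sin_gt0_pi // /t.
  rewrite mulr_gt0 ?divr_gt0 ?pi_gt0 ?ltr0n //= mulrAC ltr_pdivrMr ?ltr0n //.
  by rewrite ltr_pM2l ?pi_gt0 // ltr_nat /n; have := ltn_ord k; lia.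
rewrite qgauss_half_prod; last exact: cexpi_prim_root.
have -> : \prod_(k < m) (1 - w^-1 ^+ k.*2.+1) =
    v^-1 ^+ (m ^ 2) * ('i%C ^+ m *
      (\prod_(k < m) (2 * sin (t * k.*2.+1%:R)))%:C).
  rewrite -sum_odd -prodrXr rmorph_prod /=.
  rewrite -[X in 'i%C ^+ X](card_ord m) -prodr_const -!big_split /=.
  apply: eq_bigr => k _; rewrite -cexpiB cexpiMn -/v wE !exprVn exprAC.
  by field; rewrite expf_neq0.
(* After cancelling v^(m^2) the exponent is a multiple of n; since v^n = -1 only (-1)^m remains,
   which turns i^m into (-i)^m. *)
rewrite wE -exprM (_ : (2 * m.+1 ^ 3 = m ^ 2 + n * (m ^ 2 + 2 * m.+1))%N).
  rewrite exprD (exprM v n) vn exprVn mulrACA mulrA -mulrA.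
  rewrite [in RHS](exprNn 'i%C m).
  have -> : (-1) ^+ (m ^ 2 + 2 * m.+1) = (-1) ^+ m :> R[i].
    by rewrite exprD [X in _ * X]exprM sqrrN expr1n expr1n mulr1
      -signr_odd oddX signr_odd.
  by field; rewrite expf_neq0.
by rewrite /n -addnn; ring.
Qed.

(** Inverting a root of unity is conjugation, so [qgauss_norm] gives P^2 = n for the positive factor
    P. *)
Lemma qgauss_half (m : nat) :
  qgauss m.*2.+1 (cexpi (2 * pi / m.*2.+1%:R : R) ^+ m.+1) =
  (- 'i%C) ^+ m * (Num.sqrt m.*2.+1%:R)%:C.
Proof.
have [P P0 gE] := qgauss_half_pos m; rewrite gE.
set n := m.*2.+1 in gE *; set w := cexpi _ in gE.
suff -> : P = Num.sqrt n%:R by [].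
have [m0|m0] := posnP m.
  move: gE; rewrite /n m0 /qgauss big_ord1 !expr0 mul1r => /complexI <-.
  by rewrite sqrtr1.
have n1 : (1 < n)%N by rewrite /n; lia.
have w_prim : n.-primitive_root (w ^+ m.+1).
  rewrite prim_root_exp_coprime; last exact: cexpi_prim_root.
  by rewrite (_ : m = n./2) ?coprime_half_succ // /n; lia.
have := qgauss_norm n1 (prim_expr_order w_prim) w_prim _.
have conjX k : conjc (w ^+ k) = w^-1 ^+ k.
  by rewrite rmorphXn [X in X ^+ k]conjc_cexpi.
have -> : qgauss n (w ^+ m.+1)^-1 = conjc (qgauss n (w ^+ m.+1)).
  rewrite /qgauss rmorph_sum; apply: eq_bigr => x _.
  by rewrite exprVn -exprM [RHS]conjX exprVn.
have conjNi : conjc (- 'i%C : R[i]) = 'i%C.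
  by apply/eqP; rewrite eq_complex /= oppr0 opprK !eqxx.
rewrite gE rmorphM rmorphXn [X in _ * (X ^+ m * _)]conjNi.
rewrite [X in _ * (_ * X)]conjc_real.
rewrite mulrACA -exprMn -rmorphM mulNr -!expr2 complexiE sqrCi opprK expr1n.
rewrite mul1r -(rmorph_nat (real_complex R)) /n oddS odd_double.
move=> /(_ isT)/complexI <-.
by rewrite sqrtr_sqr gtr0_norm.
Qed.

End ComplexExponential.

(** * From the sums over theta to powers of quadratic Gauss sums *)

(** In the square of the sum the terms with i < j and those with j < i agree by symmetry. *)
Lemma theta_double (m : nat) (x : 'I_m -> int) :
  2 * theta x = \sum_i x i ^+ 2 + (\sum_i x i) ^+ 2.
Proof.
have sqrE : (\sum_i x i) ^+ 2 = \sum_i x i ^+ 2 +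
    \sum_(i < m) \sum_(j < m | (i < j)%N) x i * x j *+ 2.
  have swap : \sum_(i < m) \sum_(j < m | (j < i)%N) x i * x j =
      \sum_(i < m) \sum_(j < m | (i < j)%N) x i * x j.
    rewrite (exchange_big_dep xpredT) //=; apply: eq_bigr => j _.
    by apply: eq_bigr => i _; rewrite mulrC.
  under [X in _ + X]eq_bigr => i _ do rewrite sumrMnl.
  rewrite sumrMnl mulr2n -{1}swap -!big_split expr2 mulr_suml /=.
  apply: eq_bigr => i _.
  rewrite mulr_sumr (bigID (fun j : 'I_m => (i < j)%N)) /=.
  rewrite addrC addrA; congr (_ + _).
  rewrite (bigD1 i) ?ltnn //= expr2; congr (_ + _).
  by apply: eq_bigl => j; rewrite -leqNgt ltn_neqAle andbC -val_eqE.
rewrite sqrE /theta; under [X in _ + (_ + X)]eq_bigr => i _ do rewrite sumrMnl.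
by rewrite sumrMnl; ring.
Qed.

(** As 2h = d + 1 for h = [d./2.+1], [psi] = w^(ah) satisfies psi^2 = w^a, so the summand is [psi]
    to the power 2 theta(x). *)
Lemma gaussG_eq_qgauss (R : realType) (N d : nat) (a : int) :
  (0 < N)%N -> (1 < d)%N -> odd d -> (d %| N)%N -> gcdz a d%:Z = 1 ->
  gaussG R N.-1 a d =
    qgauss d ((cexpi (2 * pi / d%:R : R) ^+ d./2.+1) ^ a) ^+ N.
Proof.
(* In the form [d'.+2] the types ['I_d] and ['Z_d] are convertible. *)
case: d => [|[|d']] // N0 d1 dodd dN ga.
set d := d'.+2 in d1 dodd dN ga *; set w := cexpi (2 * pi / d%:R : R).
have w_prim : d.-primitive_root w by apply: cexpi_prim_root.
have d2 : (2 * d./2.+1 = d.+1)%N by lia.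
set psi := (w ^+ _) ^ a.
have psiE : psi ^ 2%:Z = w ^ a.
  rewrite /psi exprzAC -exprnP -exprM mulnC d2 exprS (prim_expr_order w_prim).
  by rewrite mulr1.
have psi_prim : d.-primitive_root psi.
  apply: prim_root_exprz ga; rewrite prim_root_exp_coprime //.
  exact: coprime_half_succ.
have dR0 : d%:R != 0 :> R[i] by rewrite pnatr_eq0.
have := sum_zchar_rootlattice d1 (prim_expr_order psi_prim) psi_prim
  (m := N.-1) dodd; rewrite prednK // => <- //.
apply: eq_bigr => x _.
set th := theta _.
have -> : 2 * pi * (a * th)%:~R / d%:R = 2 * pi / d%:R * (a * th)%:~R :> R.
  by rewrite mulrAC.
rewrite cexpi_int -/w -exprz_exp -psiE exprz_exp.
rewrite -(zchar_int d1 (prim_expr_order psi_prim)).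
congr zchar; rewrite /th theta_double rmorphD rmorphXn !rmorph_sum /=.
have natE i : ((x i : nat)%:Z)%:~R = x i :> 'Z_d by rewrite -pmulrn natr_Zp.
congr (_ + _ ^+ 2); apply: eq_bigr => i _ //.
by rewrite rmorphXn /= natE.
Qed.

Lemma squarefree_dvd (m n : nat) : (m %| n)%N -> squarefree n -> squarefree m.
Proof. by move=> mn sf k km; apply/sf/(dvdn_trans km). Qed.

(* [N - N d] is even (as [d] is odd), so the division in the exponent is exact. *)
Theorem theorem3p6 (R : realType) (N d : nat) (a : int)
    (hN0 : (0 < N)%N) (hNodd : odd N) (hNsf : squarefree N)
    (hd0 : (0 < d)%N) (hdN : (d %| N)%N) (had : gcdz a d%:Z = 1) :
  gaussG R N.-1 a d =
    (jacobi a d)%:~R * ('i%C : R[i]) ^ ((N%:Z - N%:Z * d%:Z) %/ 2)%Z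
      * ((d%:R : R) `^ (N%:R / 2))%:C.
Proof.
have dodd : odd d := dvdn_odd hdN hNodd.
have sf := squarefree_dvd hdN hNsf.
(* For d = 1 there is only the zero vector, and both sides are 1. *)
have [d1|d1] := leqP d 1.
  have -> : d = 1%N by lia.
  rewrite /jacobi big_nil mul1r mulr1 subrr div0z expr0z mul1r powR1.
  rewrite /gaussG (eq_bigr (fun _ => 1)) => [|x _].
    by rewrite sumr_const card_ffun !card_ord exp1n.
  rewrite /theta big1 => [|i _]; last by rewrite ord1 expr0n.
  rewrite big1 => [|i _]; last by rewrite big1 // => j _; rewrite ord1 mul0r.
  by rewrite addr0 !mulr0 mul0r cexpi0.
rewrite gaussG_eq_qgauss // qgauss_jacobi //; last first.
  by rewrite prim_root_exp_coprime ?coprime_half_succ ?cexpi_prim_root.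
have Ed : d = d./2.*2.+1 by lia.
have := qgauss_half R d./2; rewrite -Ed => ->.
(* As N is odd, the N-th power of the symbol is the symbol. *)
rewrite !exprMn -!mulrA; congr (_ * _).
  have -> : N = (2 * N./2 + 1)%N by lia.
  by rewrite exprD exprM -rmorphXn /= jacobi_sqr // expr1n mul1r.
congr (_ * _).
  (* With d = 2m + 1 the exponent is -mN, which matches (-i)^(mN) because -i = 1/i. *)
  have -> : ((N%:Z - N%:Z * d%:Z) %/ 2)%Z = - (d./2 * N)%N%:Z.
    have -> : N%:Z - N%:Z * d%:Z = - (d./2 * N)%N%:Z * 2 by lia.
    by rewrite mulzK.
  by rewrite -exprM -exprnN -exprVn complexiE invCi.
rewrite -rmorphXn (mulrC N%:R) powRrM powR12_sqrt ?ler0n //.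
by rewrite powR_mulrn ?sqrtr_ge0.
Qed.
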